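(* Fix $a\in[0,1)$ and let $\alpha=1-a$. There exists an $\alpha$-Hölder continuous map $\phi_a:[0,1]\to[0,1]$ such that $$\underline{\mathrm{mdim}}_{\mathrm{M}}([0,1],|\cdot|,\phi_a)=\overline{\mathrm{mdim}}_{\mathrm{M}}([0,1],|\cdot|,\phi_a)=a.$$
   Context: A map $\phi:[0,1]\to[0,1]$ is $\alpha$-Hölder continuous, for $\alpha\in(0,1]$, if there is $K>0$ with $|\phi(x)-\phi(y)|\le K|x-y|^{\alpha}$ for all $x\neq y$ in $[0,1]$ (for $\alpha=1$ this means Lipschitz continuous). Metric mean dimension: let $(X,d)$ be a compact metric space and $\phi:X\to X$ continuous. For $n\in\mathbb{N}$, $n\ge 1$, put $d_n(x,y)=\max\{d(x,y),d(\phi(x),\phi(y)),\dots,d(\phi^{n-1}(x),\phi^{n-1}(y))\}$. For $\varepsilon>0$, a set $A\subset X$ is $(n,\phi,\varepsilon)$-separated if $d_n(x,y)>\varepsilon$ for any two distinct $x,y\in A$; $\mathrm{sep}(n,\phi,\varepsilon)$ is the maximal cardinality of an $(n,\phi,\varepsilon)$-separated subset of $X$. Put $\mathrm{sep}(\phi,\varepsilon)=\limsup_{n\to\infty}\frac1n\log\mathrm{sep}(n,\phi,\varepsilon)$. The lower and upper metric mean dimensions are $$\underline{\mathrm{mdim}}_{\mathrm{M}}(X,d,\phi)=\liminf_{\varepsilon\to0}\frac{\mathrm{sep}(\phi,\varepsilon)}{|\log\varepsilon|},\qquad \overline{\mathrm{mdim}}_{\mathrm{M}}(X,d,\phi)=\limsup_{\varepsilon\to0}\frac{\mathrm{sep}(\phi,\varepsilon)}{|\log\varepsilon|}.$$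 On $[0,1]$, $|\cdot|$ denotes the metric $d(x,y)=|x-y|$. *)

(* Defs.v *)
From mathcomp Require Import all_boot all_order all_algebra finmap.
From mathcomp Require Import all_classical all_reals all_analysis.
Set Implicit Arguments.
Unset Strict Implicit.
Unset Printing Implicit Defensive.
Import Order.TTheory GRing.Theory Num.Theory.
Import numFieldNormedType.Exports.
Local Open Scope classical_set_scope.
Local Open Scope ring_scope.

Definition holder_on {R : realType} (D : set R) (alpha : R) (phi : R -> R) :=
  exists K : R, 0 < K /\
    forall x y, D x -> D y -> x != y ->
      `|phi x - phi y| <= K * `|x - y| `^ alpha.

(* A metric space (X, d) is a subset X of a type T together with a function d
   whose restriction to X is the metric. The self-map of X is a function on T
   that maps X to X, so its values outside X are never used. *)
Section metric_mean_dimension.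
Context {R : realType} {T : choiceType}.
Variables (X : set T) (d : T -> T -> R) (phi : T -> T).

(* The neutral element 0 is harmless because distances are nonnegative. *)
Definition dyn_dist (n : nat) (x y : T) : R :=
  \big[Num.max/0]_(i < n) d (iter i phi x) (iter i phi y).

Definition separated_set (n : nat) (eps : R) (A : set T) :=
  A `<=` X /\ forall x y, A x -> A y -> x != y -> eps < dyn_dist n x y.

(* The supremum is the maximal cardinality: X being compact and phi continuous
   on X, the separated subsets have uniformly bounded cardinality
   (for n and eps > 0 fixed). *)
Definition max_separated (n : nat) (eps : R) : \bar R :=
  ereal_sup [set (#|` A|%:R)%:E | A in
    [set A : {fset T} | separated_set n eps [set` A]]].

Definition sep_rate (eps : R) : \bar R :=
  limn_esup (fun n => (n%:R^-1)%:E * lne (max_separated n eps))%E.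

Definition lower_mdim : \bar R :=
  limf_einf (fun eps => sep_rate eps / `|ln eps|%:E)%E (0 : R)^'+.

Definition upper_mdim : \bar R :=
  limf_esup (fun eps => sep_rate eps / `|ln eps|%:E)%E (0 : R)^'+.

End metric_mean_dimension.

(* Main.v *)
Require Import Defs.
From mathcomp Require Import all_boot all_order all_algebra finmap.
From mathcomp Require Import all_classical all_reals all_analysis.
From mathcomp Require Import ring lra.
Import Order.TTheory GRing.Theory Num.Theory.
Import numFieldNormedType.Exports.
Local Open Scope classical_set_scope.
Local Open Scope ring_scope.

(** The witness is phi(x) = min(1, 2^(1/b) x |sin(x^(-b))|) with b = a / (1 - a),
    so that (b + 1)(1 - a) = 1. The two inequalities behind the equality have
    different origins.

    Upper bound: every (1 - a)-Hoelder self-map of [0, 1] has upper metric mean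
    dimension at most a ([holder_sep_rate_le]). Cut [0, 1] into cells of length
    eps. The image of a cell has length at most K eps^(1 - a), so it meets
    O(eps^(-a)) cells; hence an itinerary through the cells has O(eps^(-a))
    continuations at each step, and points with the same itinerary are not
    separated. So sep(phi, eps) <= a |log eps| + O(1).

    Lower bound: phi has horseshoes with many branches at all small scales
    ([oscillation_sep_rate_ge]). For M >= 1, let x range over the interval
    I = [p, q] on which u = x^(-b) runs between pi M and 2 pi M. Each of the M
    values m = M, ..., 2M - 1 gives a branch u in [pi m, pi m + pi/2], on which
    |sin u| goes from 0 to 1. The amplitude 2^(1/b) x is at least
    2^(1/b) p = q there, so phi maps each branch onto a set containing I. The
    branches are separated by gaps of order p^(b + 1), that is of order
    M^(-1/a). A horseshoe with M branches and gaps larger than eps yields M^n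
    separated orbits of length n ([horseshoe_sep_rate_ge]), and M can be chosen
    of order eps^(-a). So sep(phi, eps) >= a |log eps| - O(1). For a = 0 the
    lower bound is just sep(phi, eps) >= 0.

    The exponent b balances the two sides: the slope of phi near x has order
    x^(-b), which is what the Hoelder exponent 1 / (b + 1) = 1 - a permits
    ([oscillation_holder]). *)

(** * Limits superior and inferior along a filter *)

Lemma limf_esup_le (R : realType) (T : choiceType) (X : filteredType T)
    (F : set_system X) (f : X -> \bar R) (c : \bar R) :
  (\forall x \near F, f x <= c)%E -> (limf_esup f F <= c)%E.
Proof.
move=> fc; rewrite limf_esupE; apply: ereal_inf_le.
exists (ereal_sup (f @` [set x | f x <= c]%E)).
  by exists [set x | f x <= c]%E.
by apply: ge_ereal_sup => _ [x /= xc <-].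
Qed.

Lemma limf_esup_ge (R : realType) (T : choiceType) (X : filteredType T)
    (F : set_system X) {FF : ProperFilter F}
    (f : X -> \bar R) (c : \bar R) :
  (\forall x \near F, c <= f x)%E -> (c <= limf_esup f F)%E.
Proof.
move=> cf; rewrite limf_esupE; apply: le_ereal_inf_tmp => _ [V FV <-].
have [x [cfx Vx]] := filter_ex (filterI cf FV).
by apply: le_trans cfx _; apply: ereal_sup_ubound; exists x.
Qed.

Lemma limf_einf_ge (R : realType) (T : choiceType) (X : filteredType T)
    (F : set_system X) (f : X -> \bar R) (c : \bar R) {FF : Filter F} :
  (\forall x \near F, c <= f x)%E -> (c <= limf_einf f F)%E.
Proof.
move=> cf; rewrite /limf_einf leeNr; apply: limf_esup_le.
by apply: filterS cf => x; rewrite leeN2.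
Qed.

Lemma limf_einf_le (R : realType) (T : choiceType) (X : filteredType T)
    (F : set_system X) {FF : ProperFilter F}
    (f : X -> \bar R) (c : \bar R) :
  (\forall x \near F, f x <= c)%E -> (limf_einf f F <= c)%E.
Proof.
move=> cf; rewrite /limf_einf leeNl; apply: limf_esup_ge.
by apply: filterS cf => x; rewrite leeN2.
Qed.

(** * Growth rate of separated sets *)

Lemma lne_le_ln (R : realType) (x : \bar R) (r : R) :
  0 < r -> (x <= r%:E)%E -> (lne x <= (ln r)%:E)%E.
Proof.
move=> r0 xr; have [x0|x0] := leP x 0%E; first by rewrite le0_lneNy ?leNye.
rewrite -lne_EFin// lee_lne// in_itv /= ?leey ?andbT; first exact: ltW.
by rewrite lee_fin ltW.
Qed.

Section separated_sets.
Context {R : realType} {T : choiceType}.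
Variables (X : set T) (d : T -> T -> R) (phi : T -> T).

Lemma dyn_distP (n : nat) (eps : R) (x y : T) : 0 <= eps ->
  reflect (exists2 i, (i < n)%N & eps < d (iter i phi x) (iter i phi y))
          (eps < dyn_dist d phi n x y).
Proof.
move=> eps0; rewrite /dyn_dist; apply: (iffP idP) => [|[i ltin epsd]].
  apply: contraPP => /forall2NP h; apply/negP; rewrite -leNgt.
  apply/bigmax_leP; split=> // i _; case: (h i) => [|/negP]; last by rewrite -leNgt.
  by rewrite ltn_ord.
by apply: lt_le_trans epsd _; apply: (le_bigmax _ _ (Ordinal ltin)).
Qed.

Lemma max_separated_ge (n : nat) (eps : R) (A : {fset T}) :
  separated_set X d phi n eps [set` A] ->
  ((#|` A|%:R)%:E <= max_separated X d phi n eps)%E.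
Proof. by move=> sA; apply: ereal_sup_ubound; exists A. Qed.

Lemma max_separated_le (n : nat) (eps c : R) :
  (forall A : {fset T}, separated_set X d phi n eps [set` A] -> #|` A|%:R <= c) ->
  (max_separated X d phi n eps <= c%:E)%E.
Proof. by move=> h; apply: ge_ereal_sup => _ [A sA <-]; rewrite lee_fin h. Qed.

Lemma sep_rate_ge (eps c : R) : 0 < c ->
  (forall n, (0 < n)%N ->
    (c ^+ n)%:E <= max_separated X d phi n eps)%E ->
  ((ln c)%:E <= sep_rate X d phi eps)%E.
Proof.
move=> c0 h; apply: limf_esup_ge; near=> n.
have n0 : (0 < n)%N by near: n; exact: nbhs_infty_gt.
rewrite lee_pdivlMl ?ltr0n// -EFinM mulr_natl -lnXn//.
have cn0 : 0 < c ^+ n by rewrite exprn_gt0.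
rewrite -lne_EFin// lee_lne ?h// in_itv /= leey andbT ?lee_fin ?ltW//.
by apply: (lt_le_trans _ (h _ n0)); rewrite lte_fin.
Unshelve. all: by end_near. Qed.

(** The factor b, constant in n, is absorbed by the division by n. *)
Lemma sep_rate_le (eps b c : R) : 0 < b -> 0 < c ->
  (forall n, max_separated X d phi n eps <= (b * c ^+ n)%:E)%E ->
  (sep_rate X d phi eps <= (ln c)%:E)%E.
Proof.
move=> b0 c0 h; apply/lee_addgt0Pr => e e0; apply: limf_esup_le; near=> n.
have n0 : (0 < n)%N by near: n; exact: nbhs_infty_gt.
have nR0 : 0 < n%:R :> R by rewrite ltr0n.
have bn : ln b <= e * n%:R.
  rewrite -ler_pdivrMl// mulrC; near: n; exact: nbhs_infty_ger.
rewrite lee_pdivrMl//.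
have cn0 : 0 < c ^+ n by rewrite exprn_gt0.
apply: le_trans (lne_le_ln _ _ _ _ (h n)) _; first by rewrite mulr_gt0.
rewrite lnM ?posrE// lnXn// -EFinD -EFinM lee_fin.
by rewrite -[ln c *+ n]mulr_natl mulrDr addrC lerD2l mulrC.
Unshelve. all: by end_near. Qed.

End separated_sets.

(** * Horseshoes *)

Section horseshoe.
Context {R : realType} {T : choiceType}.
Variables (X : set T) (d : T -> T -> R) (phi : T -> T).
Variables (I : set T) (s : nat) (J : 'I_s -> set T) (i0 : 'I_s).
Hypothesis I_neq0 : I !=set0.
Hypothesis JI : forall i, J i `<=` I.
Hypothesis IphiJ : forall i, I `<=` phi @` J i.

(** Points with a prescribed itinerary are built backwards: a point following
    the tail of w lies in I, so it has a preimage in the branch named by the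
    head of w. *)
Lemma horseshoe_orbit (w : seq 'I_s) :
  exists2 x, I x & forall i, (i < size w)%N -> J (nth i0 w i) (iter i phi x).
Proof.
elim: w => [|k w [y Iy yw]]; first by have [x Ix] := I_neq0; exists x.
have [x Jx xy] := IphiJ k _ Iy; exists x; first exact: JI Jx.
by case=> [//|i] iw; rewrite iterSr xy; exact: yw.
Qed.

(** The s ^ n words of length n have pairwise separated orbits: at an index
    where two words differ, the orbits sit in branches more than eps apart. *)
Lemma horseshoe_sep_rate_ge (eps : R) :
  0 <= eps -> (forall x, d x x = 0) -> I `<=` X ->
  (forall i j x y, i != j -> J i x -> J j y -> eps < d x y) ->
  ((ln s%:R)%:E <= sep_rate X d phi eps)%E.
Proof.
move=> eps0 dxx IX sepJ.
have s0 : (0 < s)%N by exact: leq_ltn_trans (ltn_ord i0).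
apply: sep_rate_ge => [|n n0]; first by rewrite ltr0n.
have [f If Jf] : exists2 f : n.-tuple 'I_s -> T, forall w, I (f w) &
    forall (w : n.-tuple 'I_s) i, (i < n)%N ->
      J (nth i0 w i) (iter i phi (f w)).
  have /choice[f fP] (w : n.-tuple 'I_s) : exists x,
      I x /\ forall i, (i < n)%N -> J (nth i0 w i) (iter i phi x).
    by have [x Ix xw] := horseshoe_orbit w; exists x; rewrite size_tuple in xw.
  by exists f => w; have [] := fP w.
have fsep v w : v != w -> eps < dyn_dist d phi n (f v) (f w).
  move=> vw; have [i vwi] : exists i : 'I_n, tnth v i != tnth w i.
    apply/existsP; apply: contraNT vw; rewrite negb_exists => /forallP vw.
    by apply/eqP/eq_from_tnth => i; apply/eqP; rewrite -[_ == _]negbK.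
  apply/dyn_distP => //; exists i => //.
  by apply: sepJ vwi _ _; rewrite !(tnth_nth i0); exact: Jf.
have finj : injective f.
  move=> v w fvw; apply/eqP; apply: contraT => /fsep /dyn_distP[//|i _].
  by rewrite fvw dxx ltNge eps0.
have -> : s%:R ^+ n = #|` [fset f w | w in {: n.-tuple 'I_s}]%fset|%:R :> R.
  by rewrite card_imfset//= -cardE card_tuple card_ord natrX.
apply: max_separated_ge; split=> [_ /imfsetP[w _ ->]|]; first exact: IX.
move=> _ _ /imfsetP[v _ ->] /imfsetP[w _ ->] fvw; apply: fsep.
by apply: contra_neq fvw => ->.
Qed.

End horseshoe.

(** * Hoelder maps of the unit interval *)

Section holder_upper_bound.
Context {R : realType}.
Variables (phi : R -> R) (K alpha eps : R).
Hypotheses (K0 : 0 < K) (alpha0 : 0 <= alpha) (alpha1 : alpha <= 1).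
Hypothesis phi01 : set_fun `[0, 1] `[0, 1] phi.
Hypothesis holder_phi : forall x y, `[0, 1]%classic x -> `[0, 1]%classic y ->
  x != y -> `|phi x - phi y| <= K * `|x - y| `^ alpha.
Hypotheses (eps0 : 0 < eps) (eps1 : eps < 1).

Let I01 : set R := `[0, 1].
Let cell (x : R) : nat := Num.truncn (x / eps).
Let corner (x : R) : R := (cell x)%:R * eps.
(** The image of a cell meets only cells within this index distance of the cell
    that contains the image of its corner. *)
Let spread : nat := (Num.truncn (K * eps `^ (alpha - 1))).+1.

Let iter01 x n : I01 x -> I01 (iter n phi x).
Proof. by move=> x01; elim: n => //= n; exact: phi01. Qed.

Let cell_itv x : I01 x -> corner x <= x < corner x + eps.
Proof.
rewrite /I01 /= in_itv /= => /andP[x0 _].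
have /truncn_itv/andP[] : 0 <= x / eps by rewrite divr_ge0// ltW.
by rewrite -/(cell x) ler_pdivlMr// ltr_pdivrMr// -natr1 mulrDl mul1r => -> ->.
Qed.

Let corner01 x : I01 x -> I01 (corner x).
Proof.
move=> x01; have /andP[cx _] := cell_itv x x01; move: x01.
rewrite /I01 /= !in_itv /= => /andP[_ x1].
by rewrite (le_trans cx x1) andbT mulr_ge0// ltW.
Qed.

Let cell_eq x y : I01 x -> I01 y -> cell x = cell y -> `|x - y| <= eps.
Proof.
move=> /cell_itv; rewrite /corner => + /cell_itv; rewrite /corner => + + xy.
by rewrite xy ler_norml => *; lra.
Qed.

Let cell_le x y (r : R) : I01 x -> I01 y ->
  x - y <= r * eps -> (cell x <= cell y + (Num.truncn r).+1)%N.
Proof.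
move=> /cell_itv; rewrite /corner => + /cell_itv; rewrite /corner.
move=> /andP[x1 _] /andP[_ y1] xy.
have r1 := truncnS_gt r.
rewrite -ltnS -(ltr_nat R) -(ltr_pM2r eps0).
rewrite -[(_ + _).+1]addnS natrD -[(Num.truncn r).+2]addn1 natrD !mulrDl mul1r.
have : r * eps < (Num.truncn r).+1%:R * eps by rewrite ltr_pM2r.
by lra.
Qed.

Let image_cell x y : I01 x -> I01 y -> x != y -> `|x - y| <= eps ->
  (cell (phi x) <= cell (phi y) + spread)%N.
Proof.
move=> x01 y01 neq xy; apply: cell_le; [exact: phi01 ..|].
apply: (le_trans (ler_norm _)); apply: le_trans (holder_phi _ _ x01 y01 neq) _.
rewrite -mulrA ler_pM2l// -[in X in _ <= _ * X](powRr1 (ltW eps0)).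
rewrite -powRD; last by rewrite (gt_eqF eps0) implybT.
by rewrite subrK ge0_ler_powR// nnegrE ?ltW.
Qed.

Let image_cell_corner x : I01 x ->
  (cell (phi x) <= cell (phi (corner x)) + spread)%N /\
  (cell (phi (corner x)) <= cell (phi x) + spread)%N.
Proof.
move=> x01; have [<-|neq] := eqVneq x (corner x); first by rewrite leq_addr.
have xc : `|x - corner x| <= eps.
  by rewrite ler_norml; have := cell_itv x x01; lra.
split; apply: image_cell => //; try exact: corner01.
  by rewrite eq_sym.
by rewrite distrC.
Qed.

(** Index of the next cell relative to the image of the corner. Shifting by
    spread makes the truncated subtraction exact, so that the cell of phi x can
    be recovered from the cell of x and this bounded number. *)
Let step (x : R) : nat := (cell (phi x) + spread - cell (phi (corner x)))%N.

Let step_lt x : I01 x -> (step x < spread.*2.+1)%N.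
Proof.
move=> x01; have [h _] := image_cell_corner x x01.
by rewrite ltnS /step leq_subLR -addnn addnA leq_add2r.
Qed.

Let step_inj x y : I01 x -> I01 y -> cell x = cell y -> step x = step y ->
  cell (phi x) = cell (phi y).
Proof.
move=> x01 y01 xy; have cxy : corner x = corner y by rewrite /corner xy.
have [_ h1] := image_cell_corner x x01; have [_ h2] := image_cell_corner y y01.
rewrite /step -cxy in h2 *.
by move=> /(congr1 (addn^~ (cell (phi (corner x))))); rewrite /= !subnK// => /addIn.
Qed.

Let code n (x : R) : 'I_(Num.truncn eps^-1).+1 * {ffun 'I_n -> 'I_spread.*2.+1} :=
  (inord (cell x), [ffun i : 'I_n => inord (step (iter i phi x))]).

Let code_cell n x y : I01 x -> I01 y -> code n x = code n y ->
  forall i, (i < n)%N -> cell (iter i phi x) = cell (iter i phi y).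
Proof.
move=> x01 y01 [cxy /ffunP sxy].
have cell_lt z : I01 z -> (cell z < (Num.truncn eps^-1).+1)%N.
  rewrite /I01 /= in_itv /= => /andP[z0 z1]; rewrite ltnS le_truncn//.
  by rewrite ler_pdivrMr// mulVf// gt_eqF.
have {}cxy : cell x = cell y.
  by have := congr1 val cxy; rewrite /= !inordK ?cell_lt.
elim=> [//|i IH] ltin; apply: step_inj; [exact: iter01 ..|by apply/IH/ltnW|].
have := sxy (Ordinal (ltnW ltin)); rewrite !ffunE => /(congr1 val) /=.
by rewrite !inordK// step_lt//; exact: iter01.
Qed.

Let max_separated_holder n :
  (max_separated I01 (fun x y : R => `|x - y|)%R phi n eps <=
   ((Num.truncn eps^-1).+1%:R * spread.*2.+1%:R ^+ n)%:E)%E.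
Proof.
apply: max_separated_le => A [AI sepA].
rewrite -natrX -natrM ler_nat.
have -> : ((Num.truncn eps^-1).+1 * spread.*2.+1 ^ n)%N =
   #|{: 'I_(Num.truncn eps^-1).+1 * {ffun 'I_n -> 'I_spread.*2.+1}}|.
  by rewrite card_prod card_ffun !card_ord.
have inj : {in A &, injective (code n)}.
  move=> x y xA yA exy; apply/eqP; apply: contraT => neq.
  have /dyn_distP[|i ltin] := sepA x y xA yA neq; first exact: ltW.
  rewrite ltNge cell_eq//; [exact/iter01/AI..|].
  by apply: code_cell ltin => //; exact: AI.
rewrite -(size_map (code n)).
have /card_uniqP <- : uniq (map (code n) A) by rewrite map_inj_in_uniq ?fset_uniq.
exact: max_card.
Qed.

(** The number of continuations of an itinerary is 2 spread + 1, which is at most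
    (2 K + 5) eps ^ (alpha - 1); the initial cell contributes only a factor that
    does not depend on n. *)
Lemma holder_sep_rate_le :
  (sep_rate `[0%R, 1%R] (fun x y : R => `|x - y|)%R phi eps <=
   (ln (2 * K + 5) + (1 - alpha) * - ln eps)%R%:E)%E.
Proof.
have := @sep_rate_le R R _ _ _ eps _ _ _ _ max_separated_holder.
move=> h; apply: (le_trans (h _ _)).
- by rewrite ltr0n.
- by rewrite ltr0n.
have -> : (1 - alpha) * - ln eps = ln (eps `^ (alpha - 1)).
  by rewrite ln_powR mulrN -mulNr opprB.
have P0 : 0 < eps `^ (alpha - 1) by rewrite powR_gt0.
have K5 : 0 < 2 * K + 5 by rewrite addr_gt0 ?mulr_gt0.
rewrite -lnM ?posrE// lee_fin ler_ln ?posrE ?ltr0n ?mulr_gt0//.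
have P1 : 1 <= eps `^ (alpha - 1).
  by rewrite -[X in X <= _](powRr0 eps) ger_powR// ?subr_le0// eps0 ltW.
have := truncn_le (K * eps `^ (alpha - 1)).
rewrite mulr_ge0 ?powR_ge0 ?(ltW K0)// => tle.
rewrite /spread -muln2 -addn1 natrD natrM -[(Num.truncn _).+1]addn1 natrD.
(* Here t stands for the truncation in spread and v for the power of eps. *)
suff H (t k v : R) : t <= k * v -> 1 <= v -> (t + 1) * 2 + 1 <= (2 * k + 5) * v.
  by apply: H => //; rewrite tle.
by move=> tk v1; lra.
Qed.

End holder_upper_bound.

(** * The oscillating map *)

Lemma dist_sin_le (R : realType) (x y : R) : `|sin x - sin y| <= `|x - y|.
Proof.
wlog xy : x y / x <= y => [hw|].
  have [/hw//|/ltW/hw] := leP x y.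
  by rewrite distrC [in X in _ <= X -> _]distrC.
have [|c _ sinxy] := @MVT_segment R sin cos x y xy.
  by apply: continuous_subspaceT => z; exact: continuous_sin.
by rewrite distrC sinxy normrM [leRHS]distrC ler_piMl// cos_max.
Qed.

Lemma dist_min_le (R : realType) (c x y : R) :
  `|Num.min c x - Num.min c y| <= `|x - y|.
Proof.
have := ler_norm (x - y); have := ler_norm (y - x); rewrite (distrC y).
have := normr_ge0 (x - y); rewrite ler_norml !minElt.
by case: (ltP c x); case: (ltP c y); lra.
Qed.

Lemma powRN_le (R : realType) (c x y : R) :
  0 <= c -> 0 < x -> x <= y -> y `^ (- c) <= x `^ (- c).
Proof.
move=> c0 x0 xy; have y0 := lt_le_trans x0 xy.
by rewrite !powRN lef_pV2 ?posrE ?powR_gt0// ge0_ler_powR// nnegrE ltW.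
Qed.

(** Writing r = x / y, this is 1 - r^(-b) <= b ln r <= b (r - 1), scaled by
    y^(-b). It serves twice: it bounds the oscillation of phi from above, and it
    bounds the gaps between the branches of the horseshoe from below. *)
Lemma dist_powRN_le (R : realType) (b x y : R) :
  0 <= b -> 0 < y -> y <= x ->
  `|x `^ (- b) - y `^ (- b)| <= b * (y `^ (- b - 1) * (x - y)).
Proof.
move=> b0 y0 yx; have x0 := lt_le_trans y0 yx.
rewrite ler0_norm ?subr_le0 ?powRN_le// opprB.
have yV : y `^ (- b - 1) = y `^ (- b) / y.
  by rewrite powRB ?powRr1 ?ltW// (gt_eqF y0) implybT.
have -> : x = y * (x / y) by rewrite mulrC divfK// gt_eqF.
set r := x / y; have r1 : 1 <= r by rewrite ler_pdivlMr ?mul1r.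
have r0 := lt_le_trans ltr01 r1.
rewrite powRM; [|exact: ltW|exact: ltW]; rewrite yV.
have rb : 1 - b * (r - 1) <= r `^ (- b).
  rewrite /powR gt_eqF//; apply: le_trans (expR_ge1Dx _).
  have lnr : ln r <= r - 1.
    by rewrite -[X in ln X](subrKC 1) le_ln1Dx//; lra.
  by rewrite mulNr lerD2l lerN2 ler_wpM2l.
have -> : b * (y `^ (- b) / y * (y * r - y)) = y `^ (- b) * (b * (r - 1)).
  by field; rewrite gt_eqF.
move: rb; rewrite -subr_ge0 => /(mulr_ge0 (powR_ge0 y (- b))).
by move: (y `^ _) (r `^ _) => P Q; lra.
Qed.

Section oscillating_map.
Context {R : realType}.
Variable b : R.
Hypothesis b0 : 0 <= b.

(** The factor 2^(1/b) is the ratio of the endpoints of an interval on which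
    x^(-b) varies by a factor 2: peaks over such an interval exceed its right
    end. For b = 0 the convention 1/0 = 0 makes this factor 1. *)
Definition oscillation (x : R) : R :=
  Num.min 1 (2 `^ b^-1 * x * `|sin (x `^ (- b))|).

Lemma oscillation01 : set_fun `[0, 1] `[0, 1] oscillation.
Proof.
move=> x; rewrite /= !in_itv /= => /andP[x0 _].
by rewrite ge_min lexx le_min ler01 /= andbT !mulr_ge0 ?powR_ge0.
Qed.

(** With y < x, the amplitude contributes x - y, and the wave contributes
    y |s - t|, where |s - t| is at most both 1 and b z for
    z = y^(-b - 1) (x - y). Both bounds are controlled by z^alpha, and
    y z^alpha = (x - y)^alpha because (b + 1) alpha = 1. *)
Lemma oscillation_modulus (alpha x y : R) : (b + 1) * alpha = 1 ->
  0 <= y -> y < x -> x <= 1 ->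
  `|oscillation x - oscillation y| <= 2 `^ b^-1 * (2 + b) * (x - y) `^ alpha.
Proof.
move=> balpha y0 yx x1.
have b1 : 1 <= b + 1 by rewrite lerDr.
have b1_gt0 := lt_le_trans ltr01 b1.
have alphaE : alpha = (b + 1)^-1.
  by apply: (mulfI (lt0r_neq0 b1_gt0)); rewrite balpha mulfV// lt0r_neq0.
have alpha0 : 0 <= alpha by rewrite alphaE invr_ge0 ltW.
have alpha1 : alpha <= 1 by rewrite alphaE invf_le1.
set A := 2 `^ b^-1; have A0 : 0 <= A by rewrite powR_ge0.
apply: le_trans (dist_min_le _ _ _ _) _.
rewrite -!mulrA -mulrBr normrM (ger0_norm A0) ler_wpM2l//.
set s := `|sin (x `^ (- b))|; set t := `|sin (y `^ (- b))|.
have xy01 : 0 < x - y <= 1 by lra.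
have xyal : x - y <= (x - y) `^ alpha by rewrite ger1_powR.
have s01 : 0 <= s <= 1 by rewrite normr_ge0 sin_max.
have t01 : 0 <= t <= 1 by rewrite normr_ge0 sin_max.
have -> : x * s - y * t = (x - y) * s + y * (s - t) by lra.
rewrite (_ : (2 + b) * _ =
  (x - y) `^ alpha + (1 + b) * (x - y) `^ alpha); last by ring.
apply: (le_trans (ler_normD _ _)); rewrite !normrM; apply: lerD.
  rewrite !ger0_norm; [nra|lra|lra].
rewrite (ger0_norm y0).
have [->|yn0] := eqVneq y 0; first by rewrite mul0r mulr_ge0 ?powR_ge0//; lra.
have {yn0}y0 : 0 < y by rewrite lt_neqAle eq_sym yn0.
set z := y `^ (- b - 1) * (x - y).
have z0 : 0 < z by rewrite mulr_gt0 ?powR_gt0//; lra.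
have -> : (x - y) `^ alpha = y * z `^ alpha.
  rewrite powRM ?powR_ge0//; last by lra.
  rewrite -powRrM mulrA (_ : (- b - 1) * alpha = - 1); last by lra.
  by rewrite powR_inv1 ?ltW// mulfV ?mul1r// gt_eqF.
rewrite mulrCA ler_pM2l//.
have stz : `|s - t| <= b * z.
  apply: le_trans (dist_powRN_le _ _ _ _ b0 y0 (ltW yx)).
  by apply: le_trans (dist_sin_le _ _ _); exact: ler_dist_dist.
have st1 : `|s - t| <= 1 by rewrite ler_norml; lra.
have [z1|z1] := leP z 1.
  have zal : z <= z `^ alpha by rewrite ger1_powR// z0.
  by nra.
have : 1 <= z `^ alpha by rewrite -[X in X <= _](powRr0 z) ler_powR// ltW.
by nra.
Qed.

Lemma oscillation_holder (alpha : R) : (b + 1) * alpha = 1 ->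
  holder_on `[0, 1] alpha oscillation.
Proof.
move=> balpha; exists (2 `^ b^-1 * (2 + b)); split.
  by rewrite mulr_gt0 ?powR_gt0// ltr_wpDr.
move=> x y; rewrite /= !in_itv /= => /andP[x0 x1] /andP[y0 y1].
rewrite neq_lt => /orP[xy|yx].
  rewrite distrC [in leRHS]distrC [in leRHS]gtr0_norm ?subr_gt0//.
  by rewrite oscillation_modulus.
by rewrite [in leRHS]gtr0_norm ?subr_gt0// oscillation_modulus.
Qed.

Lemma continuous_oscillation (x : R) : 0 < x -> {for x, continuous oscillation}.
Proof.
move=> x0.
apply: (@continuous_min R R (cst 1)); first exact: cst_continuous.
apply: continuousM.
  by apply: continuousM; [exact: cst_continuous|exact: cvg_id].
apply: continuous_comp; last exact: norm_continuous.
apply: continuous_comp; last exact: continuous_sin.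
apply/differentiable_continuous/derivable1_diffP/derivable_powR.
by rewrite in_itv /= x0.
Qed.

End oscillating_map.

(** * The horseshoes of the oscillating map *)

Section oscillating_horseshoe.
Context {R : realType}.
Variables (b : R) (M : nat) (eps : R).
Hypotheses (b0 : 0 < b) (M0 : (0 < M)%N) (eps0 : 0 <= eps).
Hypothesis eps_small : eps * b * (2 * (pi * M%:R)) `^ (1 + b^-1) < pi / 2.

(** Inverse of the phase x |-> x ^ (- b). *)
Let h (u : R) := u `^ (- b^-1).

Let b0' : 0 <= b^-1. Proof. by rewrite invr_ge0 ltW. Qed.

Let hK u : 0 < u -> h u `^ (- b) = u.
Proof. by move=> u0; rewrite -powRrM mulrNN mulVf ?gt_eqF// powRr1// ltW. Qed.

Let piM : 1 <= pi * M%:R :> R.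
Proof.
have M1 : 1 <= M%:R :> R by rewrite ler1n.
by have pi2 := @pi_ge2 R; nra.
Qed.

Let p := h (2 * (pi * M%:R)).
Let q := h (pi * M%:R).

Let p_gt0 : 0 < p. Proof. by have h1 := piM; rewrite powR_gt0//; lra. Qed.

Let pq : q = 2 `^ b^-1 * p.
Proof.
rewrite /p /q /h [in RHS]powRM ?mulr_ge0 ?pi_ge0//.
by rewrite mulrA [2 `^ (- _)]powRN mulfV ?mul1r// gt_eqF ?powR_gt0.
Qed.

Let q_le1 : q <= 1.
Proof. by rewrite -(powRr0 (pi * M%:R)) ler_powR// oppr_le0. Qed.

Let I : set R := `[p, q].
Let J (i : 'I_M) : set R :=
  I `&` [set x | pi * (M + i)%:R <= x `^ (- b) <= pi * (M + i)%:R + pi / 2].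

(** At the left end of a branch |sin| is 1 and the amplitude is at least q; at
    the right end |sin| is 0. The intermediate value theorem gives the rest. *)
Let J_onto i : I `<=` oscillation b @` J i.
Proof.
move=> v; rewrite /I /= in_itv /= => /andP[pv vq].
pose u : R := pi * (M + i)%:R.
have pi0 := @pi_gt0 R.
have uM : pi * M%:R <= u by rewrite ler_pM2l// ler_nat leq_addr.
have u2M : u + pi / 2 <= 2 * (pi * M%:R).
  have : (M + i).+1%:R <= 2 * M%:R :> R.
    by rewrite -natrM ler_nat mul2n -addnn -addnS leq_add2l.
  by rewrite -natr1 /u; nra.
have u0 : 0 < u by lra.
have pL : p <= h (u + pi / 2) by rewrite powRN_le//; lra.
have Lr : h (u + pi / 2) <= h u by rewrite powRN_le//; lra.
have rq : h u <= q by rewrite powRN_le//; lra.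
have L0 : 0 < h (u + pi / 2) by exact: lt_le_trans p_gt0 pL.
have sinu (c : R) : `|sin (c + u)| = `|sin c|.
  rewrite /u mulr_natr (alternatingn (@sinDpi R)).
  by rewrite normrM normrX normrN1 expr1n mul1r.
have fL : q <= oscillation b (h (u + pi / 2)).
  rewrite /oscillation hK; last by lra.
  rewrite addrC sinu sin_pihalf normr1 mulr1 le_min q_le1 pq.
  by rewrite ler_pM2l ?powR_gt0// addrC.
have fR : oscillation b (h u) = 0.
  rewrite /oscillation hK// -[u]add0r sinu sin0 normr0 mulr0.
  by rewrite min_r.
have [||x xLr xv] := @IVT R (oscillation b) _ _ v Lr.
- apply: continuous_in_subspaceT => x; rewrite inE /= in_itv /= => /andP[Lx _].
  by apply: continuous_oscillation; exact: lt_le_trans L0 Lx.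
- rewrite fR ge_min le_max (le_trans vq fL) andbT.
  by rewrite (le_trans (ltW p_gt0) pv) orbT.
exists x => //; move: xLr; rewrite in_itv /= => /andP[Lx xr]; split.
  by rewrite /I /= in_itv /= (le_trans pL Lx) (le_trans xr rq).
have x0 : 0 < x := lt_le_trans L0 Lx.
rewrite /= -/u -{1}(hK u u0) powRN_le ?(ltW b0)//=.
by rewrite -[leRHS]hK ?powRN_le ?(ltW b0)// addr_gt0 ?divr_gt0.
Qed.

(** Phases in different branches differ by at least pi / 2, and the phase is
    Lipschitz on I with constant b p^(-b - 1) = b (2 pi M)^(1 + 1/b). *)
Let J_apart i j x y : i != j -> J i x -> J j y -> eps < `|x - y|.
Proof.
wlog yx : i j x y / y <= x => [hw|].
  have [yx|/ltW xy] := leP y x; first exact: hw.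
  by rewrite eq_sym distrC => ij Jx Jy; apply: (hw j i).
move=> ij [_ /= xJ] [+ /= yJ]; rewrite /I /= in_itv /= => /andP[py _].
have pi0 := @pi_gt0 R.
have gap : pi / 2 <= `|x `^ (- b) - y `^ (- b)|.
  have far (k l : 'I_M) : (k < l)%N ->
      pi * (M + k)%:R + pi <= pi * (M + l)%:R :> R.
    move=> kl; rewrite -[X in _ + X <= _]mulr1 -mulrDr natr1 ler_pM2l//.
    by rewrite ler_nat -addnS leq_add2l.
  move: ij; rewrite -val_eqE neq_ltn => /orP[/far|/far] ?.
    by rewrite distrC ger0_norm; lra.
  by rewrite ger0_norm; lra.
have y0 := lt_le_trans p_gt0 py.
have bxy := dist_powRN_le _ _ _ _ (ltW b0) y0 yx.
have yp : y `^ (- b - 1) <= (2 * (pi * M%:R)) `^ (1 + b^-1).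
  rewrite -opprD; apply: (@le_trans _ _ (p `^ (- (b + 1)))).
    by apply: powRN_le => //; rewrite addr_ge0// ltW.
  by rewrite /p /h -powRrM mulrNN mulrDr mulr1 mulVf ?gt_eqF.
rewrite [ltRHS]ger0_norm ?subr_ge0//.
have small := eps_small.
set P := _ `^ (1 + _) in small yp *.
rewrite ltNge; apply/negP => xyeps.
have : b * (y `^ (- b - 1) * (x - y)) <= eps * b * P.
  rewrite [eps * b]mulrC -mulrA ler_pM2l// [eps * P]mulrC.
  by rewrite ler_pM ?powR_ge0 ?subr_ge0.
by move=> /(le_trans bxy)/(le_trans gap); rewrite leNgt small.
Qed.

Lemma oscillation_sep_rate_ge :
  ((ln M%:R)%:E <=
   sep_rate `[0%R, 1%R] (fun x y : R => `|x - y|)%R (oscillation b) eps)%E.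
Proof.
apply: (@horseshoe_sep_rate_ge _ _ _ _ _ I M J (Ordinal M0)) => //.
- exists p; rewrite /I /= in_itv /= lexx pq ler_peMl ?(ltW p_gt0)//.
  by rewrite -[X in X <= _](powRr0 2) ler_powR// ler1n.
- by move=> i x [].
- by move=> x; rewrite subrr normr0.
- move=> x; rewrite /I /= !in_itv /=.
  by move: p_gt0 q_le1 => ? ? /andP[? ?]; apply/andP; split; lra.
Qed.

End oscillating_horseshoe.

(** * Metric mean dimension *)

Lemma sep_rate_ge0 (R : realType) (T : choiceType) (X : set T)
    (d : T -> T -> R) (phi : T -> T) (eps : R) :
  X !=set0 -> (0 <= sep_rate X d phi eps)%E.
Proof.
move=> [x Xx]; have -> : 0%E = (ln 1)%:E :> \bar R by rewrite ln1.
apply: sep_rate_ge => // n n0.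
rewrite expr1n -[1%R]/(1%:R) -(cardfs1 x); apply: max_separated_ge.
split=> [y /=|y z /=]; first by rewrite inE => /eqP ->.
by rewrite !inE => /eqP -> /eqP ->; rewrite eqxx.
Qed.

Lemma mdim_eq (R : realType) (T : choiceType) (X : set T) (d : T -> T -> R)
    (phi : T -> T) (a C : R) :
  (\forall eps \near (0 : R)^'+,
    (a * - ln eps - C)%:E <= sep_rate X d phi eps)%E ->
  (\forall eps \near (0 : R)^'+,
    sep_rate X d phi eps <= (a * - ln eps + C)%:E)%E ->
  lower_mdim X d phi = a%:E /\ upper_mdim X d phi = a%:E.
Proof.
move=> lo up.
have ratio e : 0 < e -> \forall eps \near (0 : R)^'+,
    ((a - e)%:E <= sep_rate X d phi eps / `|ln eps|%:E <= (a + e)%:E)%E.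
  move=> e0; near=> eps.
  have eps0 : 0 < eps by near: eps; exact: nbhs_right_gt.
  have eps1 : eps < 1 by near: eps; exact: nbhs_right_lt.
  have ln0 : 0 < - ln eps by rewrite oppr_gt0 ln_lt0// eps0.
  have Ce : C <= e * - ln eps.
    rewrite -ler_pdivrMl// lerNr; near: eps.
    exact: cvgrNy_le (@lnNy R) _.
  rewrite ltr0_norm -?oppr_gt0// inver gt_eqF//.
  rewrite lee_pdivlMr// lee_pdivrMr//; apply/andP; split.
    apply: (@le_trans _ _ (a * - ln eps - C)%:E); last by near: eps.
    by rewrite -EFinM lee_fin mulrBl lerD2l lerN2.
  apply: (@le_trans _ _ (a * - ln eps + C)%:E); first by near: eps.
  by rewrite -EFinM lee_fin mulrDl lerD2l.
split; apply/eqP; rewrite eq_le; apply/andP; split.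
- apply/lee_addgt0Pr => e /ratio h; apply: limf_einf_le.
  by apply: filterS h => x /andP[].
- apply/lee_subgt0Pr => e /ratio h; apply: limf_einf_ge.
  by apply: filterS h => x /andP[].
- apply/lee_addgt0Pr => e /ratio h; apply: limf_esup_le.
  by apply: filterS h => x /andP[].
- apply/lee_subgt0Pr => e /ratio h; apply: limf_esup_ge.
  by apply: filterS h => x /andP[].
Unshelve. all: by end_near. Qed.

(** Take M to be the integer part of Y = (k eps)^(-a), where a = b / (b + 1) and
    k collects the constants of the horseshoe, so that eps is below its gaps;
    then ln M >= ln (Y / 2) = a |ln eps| - O(1). *)
Lemma oscillation_sep_rate_near_ge (R : realType) (b : R) : 0 < b ->
  exists C : R, \forall eps \near (0 : R)^'+,
    ((b / (b + 1) * - ln eps - C)%:E <=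
     sep_rate `[0%R, 1%R] (fun x y : R => `|x - y|)%R (oscillation b) eps)%E.
Proof.
move=> b0; set a := b / (b + 1).
have b1 : 0 < b + 1 by rewrite addr_gt0.
have a0 : 0 < a by rewrite divr_gt0.
have aV : a^-1 = 1 + b^-1 by rewrite /a; field; rewrite !gt_eqF.
have pi0 := @pi_gt0 R.
pose k : R := b * (2 * pi) `^ a^-1 * (4 / pi).
have k0 : 0 < k by rewrite !mulr_gt0 ?powR_gt0 ?mulr_gt0 ?invr_gt0.
exists (a * ln k + ln 2); near=> eps.
have eps0 : 0 < eps by near: eps; exact: nbhs_right_gt.
have epsk : eps * k <= 1.
  rewrite -ler_pdivlMr// mul1r; near: eps.
  by apply: nbhs_right_le; rewrite invr_gt0.
have ek0 : 0 < eps * k by rewrite mulr_gt0.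
pose Y := (eps * k) `^ (- a).
have Y1 : 1 <= Y.
  by rewrite /Y -[X in X <= _](powRr0 (eps * k)) ger_powR ?ek0// oppr_le0 ltW.
pose M := Num.truncn Y.
have M0 : (0 < M)%N by rewrite truncn_gt0.
have M0R : 0 < M%:R :> R by rewrite ltr0n.
have /andP[MY YM] : M%:R <= Y < M%:R + 1.
  by rewrite natr1 truncn_itv// (le_trans ler01).
have M1 : 1 <= M%:R :> R by rewrite ler1n.
apply: le_trans (@oscillation_sep_rate_ge R b M eps b0 M0 (ltW eps0) _); last first.
  rewrite -aV mulrA powRM ?mulr_ge0 ?(ltW pi0)//.
  have Ma : (eps * k) * M%:R `^ a^-1 <= 1.
    have : M%:R `^ a^-1 <= Y `^ a^-1.
      by rewrite ge0_ler_powR ?nnegrE ?invr_ge0 ?(ltW a0) ?(le_trans ler01 Y1).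
    rewrite /Y -powRrM mulNr mulfV ?gt_eqF// powR_inv1 ?(ltW ek0)// => h.
    by rewrite -[leRHS](mulfV (lt0r_neq0 ek0)) ler_pM2l.
  have -> : eps * b * ((2 * pi) `^ a^-1 * M%:R `^ a^-1) =
            eps * k * M%:R `^ a^-1 * (pi / 4).
    (* pi is generalized, lest its definition be unfolded by field. *)
    rewrite /k; move: (@pi R) pi0 ((2 * pi) `^ _) (M%:R `^ _) => u u0 P Q.
    by field; rewrite gt_eqF. 
  by nra.
rewrite lee_fin.
have -> : a * - ln eps - (a * ln k + ln 2) = ln (Y / 2).
  rewrite ln_div ?posrE ?powR_gt0// /Y ln_powR lnM ?posrE//; lra.
by rewrite ler_ln ?posrE ?divr_gt0 ?powR_gt0//; lra.
Unshelve. all: by end_near. Qed.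

Theorem theorem4p5 (R : realType) (a : R) (a_ge0 : 0 <= a) (a_lt1 : a < 1) :
  exists phi : R -> R,
    [/\ set_fun `[0, 1] `[0, 1] phi,
        holder_on `[0, 1] (1 - a) phi,
        lower_mdim `[0, 1] (fun x y : R => `|x - y|) phi = a%:E &
        upper_mdim `[0, 1] (fun x y : R => `|x - y|) phi = a%:E].
Proof.
have a1 : 0 < 1 - a by rewrite subr_gt0.
pose b := a / (1 - a).
have b0 : 0 <= b by rewrite divr_ge0// ltW.
have b1 : (b + 1) * (1 - a) = 1 by rewrite /b; field; rewrite gt_eqF.
have [K [K0 holderK]] := @oscillation_holder R b b0 _ b1.
exists (oscillation b).
have [C lo] : exists C : R, \forall eps \near (0 : R)^'+,
    ((a * - ln eps - C)%:E <=
     sep_rate `[0%R, 1%R] (fun x y : R => `|x - y|)%R (oscillation b) eps)%E.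
  have [a0|an0] := eqVneq a 0.
    exists 0; near=> eps; rewrite a0 mul0r subr0; apply: sep_rate_ge0.
    by exists 0; rewrite /= in_itv /= lexx ler01.
  have a_gt0 : 0 < a by rewrite lt_neqAle eq_sym an0.
  have ab : a = b / (b + 1).
    by rewrite (mulr1_eq b1) divfK// gt_eqF.
  have [C lo] := oscillation_sep_rate_near_ge R b (divr_gt0 a_gt0 a1).
  by exists C; apply: filterS lo => eps; rewrite -ab.
pose D := Num.max C (ln (2 * K + 5)).
have [||lowerE upperE] := @mdim_eq R R `[0, 1] (fun x y => `|x - y|) (oscillation b) a D.
- apply: filterS lo => eps; apply: le_trans.
  by rewrite lee_fin lerD2l lerN2 le_max lexx.
- near=> eps.
  have eps0 : 0 < eps by near: eps; exact: nbhs_right_gt.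
  have eps1 : eps < 1 by near: eps; exact: nbhs_right_lt.
  have a1_le1 : 1 - a <= 1 by rewrite gerBl.
  have := @holder_sep_rate_le R (oscillation b) K (1 - a) eps K0 (ltW a1) a1_le1
    (oscillation01 b) holderK eps0 eps1.
  rewrite opprB subrKC => /le_trans; apply.
  by rewrite lee_fin addrC lerD2l le_max lexx orbT.
by split=> //; [exact: oscillation01|exists K].
Unshelve. all: by end_near. Qed.
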